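(* Let $X$ be a discrete (uniformly discrete) metric space with bounded geometry and $\Gamma$ a countable discrete group acting properly, freely and isometrically on $X$ from the right. Then the equivariant coarse groupoid $G(X,\Gamma)$ is an étale groupoid.
   Context: Bounded geometry: $\sup_{x\in X}\#B(x,R)<\infty$ for all $R\ge 0$. $\beta D$ is the Stone--Čech compactification of a discrete space $D$. Let $\Gamma$ act diagonally on $X\times X$, $(x,y)\gamma=(x\gamma,y\gamma)$, and let $\Delta_R=\{(x,y)\in X\times X:d(x,y)\le R\}$. The equivariant coarse groupoid is $$G(X,\Gamma)=\bigcup_{R\ge0}\overline{\Delta_R/\Gamma}\subseteq\beta((X\times X)/\Gamma)$$ with the subspace topology. Its range and source maps $r,s:G(X,\Gamma)\to\beta(X/\Gamma)$, inverse, and unit map are the restrictions of the continuous extensions to Stone--Čech compactifications of $[x,y]\mapsto[x]$, $[x,y]\mapsto[y]$, $[x,y]\mapsto[y,x]$, $[x]\mapsto[x,x]$. Composition is the continuous extension of $[x,y]\circ[y\gamma,z]=[x,z\gamma^{-1}]$, defined on composable pairs $\Delta_{R_1}/\Gamma\times_{X/\Gamma}\Delta_{R_2}/\Gamma\to\Delta_{R_1+R_2}/\Gamma$, to $\overline{\Delta_{R_1}/\Gamma}\times_{\beta(X/\Gamma)}\overline{\Delta_{R_2}/\Gamma}$ for all $R_1,R_2$ (using that this fibered product is canonically $\beta(\Delta_{R_1}/\Gamma\times_{X/\Gamma}\Delta_{R_2}/\Gamma)$). A topological groupoid is étale if its range and source maps are local homeomorphisms. *)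

(* Defs.v *)
From HB Require Import structures.
From mathcomp Require Import all_boot all_order all_algebra.
From mathcomp Require Import all_classical all_reals topology.

Set Implicit Arguments.
Unset Strict Implicit.
Unset Printing Implicit Defensive.

Import Order.TTheory GRing.Theory Num.Theory.
Local Open Scope classical_set_scope.
Local Open Scope ring_scope.
Local Open Scope quotient_scope.
Local Open Scope card_scope.

(* The Stone-Cech compactification of a discrete space D, as the space of
   ultrafilters on D. The lemmas [stone_cech_compact], [stone_cech_hausdorff],
   [sc_unit_dense] and [stone_cech_universal] show that it is the
   compactification characterised by the usual universal property, and
   [sc_map_continuous], [sc_map_unit] and [sc_map_unique] that [sc_map f] is
   the continuous extension of f. *)

Record stone_cech (D : Type) : Type := StoneCech {
  sc_filter :> set D -> Prop;
  sc_ultra : UltraFilter sc_filter }.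

HB.instance Definition _ (D : Type) := gen_eqMixin (stone_cech D).
HB.instance Definition _ (D : Type) := gen_choiceMixin (stone_cech D).

Lemma sc_eq (D : Type) (p q : stone_cech D) :
  (forall A, p A -> q A) -> p = q.
Proof.
case: p q => [p up] [q uq] /= pq.
have e : q = p by apply: max_filter => //; exact: ultra_proper.
by subst q; congr StoneCech; exact: Prop_irrelevance.
Qed.

Lemma sc_filterI (D : Type) (p : stone_cech D) (A B : set D) :
  p A -> p B -> p (A `&` B).
Proof. by have := sc_ultra p => -[[_ F] _]; exact: filterI. Qed.

Lemma sc_filterS (D : Type) (p : stone_cech D) (A B : set D) :
  A `<=` B -> p A -> p B.
Proof. by have := sc_ultra p => -[[_ F] _]; exact: filterS. Qed.

Lemma sc_filterT (D : Type) (p : stone_cech D) : p setT.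
Proof. by have := sc_ultra p => -[[_ F] _]; exact: filterT. Qed.

Lemma sc_filter0 (D : Type) (p : stone_cech D) : ~ p set0.
Proof. by have := sc_ultra p => -[[F _] _]. Qed.

Lemma sc_filterC (D : Type) (p : stone_cech D) (A : set D) :
  p A \/ p (~` A).
Proof. exact: (in_ultra_setVsetC A (sc_ultra p)). Qed.

Definition sc_basic (D : Type) (A : set D) : set (stone_cech D) :=
  [set p | p A].

Definition sc_open (D : Type) (U : set (stone_cech D)) : Prop :=
  forall p, U p -> exists2 A, sc_basic A p & sc_basic A `<=` U.

Lemma sc_openT (D : Type) : @sc_open D setT.
Proof. by move=> p _; exists setT => //; exact: sc_filterT. Qed.

Lemma sc_openI (D : Type) : setI_closed (@sc_open D).
Proof.
move=> U V oU oV p [/oU[A pA AU] /oV[B pB BV]]; exists (A `&` B).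
  exact: sc_filterI.
by move=> q qAB; split; [apply: AU | apply: BV];
  apply: sc_filterS qAB => x [].
Qed.

Lemma sc_open_bigU (D I : Type) (U : I -> set (stone_cech D)) :
  (forall i, sc_open (U i)) -> sc_open (\bigcup_i U i).
Proof.
move=> oU p [i _ /oU[A pA AU]]; exists A => // q /AU Uq; by exists i.
Qed.

HB.instance Definition _ (D : Type) :=
  isOpenTopological.Build (stone_cech D)
    (@sc_openT D) (@sc_openI D) (@sc_open_bigU D).

Lemma sc_openE (D : Type) (U : set (stone_cech D)) : open U = sc_open U.
Proof. by []. Qed.

Lemma sc_basic_open (D : Type) (A : set D) : open (sc_basic A).
Proof. by rewrite sc_openE => p pA; exists A. Qed.

Lemma sc_nbhsP (D : Type) (p : stone_cech D) (U : set (stone_cech D)) :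
  nbhs p U <-> exists2 A, p A & sc_basic A `<=` U.
Proof.
rewrite nbhsE; split=> [[V [oV Vp] VU]|[A pA AU]].
  by have [A pA AV] := oV p Vp; exists A => //; exact: subset_trans VU.
by exists (sc_basic A) => //; split=> //; exact: sc_basic_open.
Qed.

Definition sc_unit (D : Type) (x : D) : stone_cech D :=
  StoneCech (principal_filter_ultra x).

Lemma sc_unitE (D : Type) (x : D) (A : set D) : sc_unit x A <-> A x.
Proof. exact: principal_filterP. Qed.

Lemma sc_closureP (D : Type) (A : set D) (p : stone_cech D) :
  closure (@sc_unit D @` A) p <-> p A.
Proof.
split=> [pA|pA U /sc_nbhsP[B pB BU]].
  have [//|pnA] := sc_filterC p A.
  have nb : nbhs p (sc_basic (~` A)) by apply/sc_nbhsP; exists (~` A).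
  by have [_ [[x Ax <-] /sc_unitE]] := pA _ nb.
have [A0|/set0P[x [Ax Bx]]] := eqVneq (A `&` B) set0.
  by have := sc_filterI pA pB; rewrite A0 => /sc_filter0.
by exists (sc_unit x); split; [exists x | apply/BU/sc_unitE].
Qed.

Lemma sc_unit_dense (D : Type) : closure (range (@sc_unit D)) = setT.
Proof.
by rewrite eqEsubset; split=> // p _; apply/sc_closureP; exact: sc_filterT.
Qed.

Lemma stone_cech_hausdorff (D : Type) : hausdorff_space (stone_cech D).
Proof.
move=> p q pq; apply: sc_eq => A pA.
have [//|qnA] := sc_filterC q A.
have np : nbhs p (sc_basic A) by apply/sc_nbhsP; exists A.
have nq : nbhs q (sc_basic (~` A)) by apply/sc_nbhsP; exists (~` A).
have [x [xA xnA]] := pq _ _ np nq.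
by have := sc_filterI xA xnA; rewrite setICr => /sc_filter0.
Qed.

Lemma stone_cech_compact (D : Type) : compact [set: stone_cech D].
Proof.
rewrite compact_ultra => F FU _.
pose p : set_system D := [set A | F (sc_basic A)].
have pF : ProperFilter p.
  split.
    rewrite /p /= => F0; have /filter_ex[q] := F0; exact: sc_filter0.
  split=> [|A B FA FB|A B AB].
  - apply: (@filterS _ F _ setT) => [q _|]; [exact: sc_filterT | exact: filterT].
  - have FAB : F (sc_basic A `&` sc_basic B) by exact: filterI.
    by apply: filterS FAB => q [*]; exact: sc_filterI.
  - by apply: (@filterS _ F) => q; exact: sc_filterS.
have pU : UltraFilter p.
  split=> // G GF pG; rewrite eqEsubset; split=> // A GA.
  have [//|FnA] := in_ultra_setVsetC (sc_basic A) FU.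
  have : p (~` A).
    by apply: filterS FnA => q; have [|] := sc_filterC q A.
  move=> /pG GnA; have : G (A `&` ~` A) by exact: filterI.
  by rewrite setICr => /filter_not_empty.
exists (StoneCech pU); split=> // U /sc_nbhsP[A pA AU].
exact: filterS AU pA.
Qed.

Lemma sc_map_subproof (D E : Type) (f : D -> E) (p : stone_cech D) :
  UltraFilter (fmap f p).
Proof.
have [pF _] := sc_ultra p; split; first exact: fmap_proper_filter.
move=> G GF pG; rewrite eqEsubset; split=> // A GA.
have [//|pnA] := sc_filterC p (f @^-1` A).
have GnA : G (~` A) by exact: pG.
have : G (A `&` ~` A) by exact: filterI.
by rewrite setICr => /filter_not_empty.
Qed.

Definition sc_map (D E : Type) (f : D -> E) (p : stone_cech D) :
  stone_cech E := StoneCech (sc_map_subproof f p).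

Lemma sc_map_unit (D E : Type) (f : D -> E) (x : D) :
  sc_map f (sc_unit x) = sc_unit (f x).
Proof. by apply: sc_eq => A /sc_unitE Afx; apply/sc_unitE. Qed.

Lemma sc_map_continuous (D E : Type) (f : D -> E) : continuous (sc_map f).
Proof.
move=> p U /sc_nbhsP[A pA AU]; apply/sc_nbhsP.
by exists (f @^-1` A) => // q qA; exact: AU.
Qed.

Lemma sc_ext_unique (D : Type) (K : topologicalType)
    (g h : stone_cech D -> K) :
  hausdorff_space K -> continuous g -> continuous h ->
  (forall x, g (sc_unit x) = h (sc_unit x)) -> g = h.
Proof.
move=> hK cg ch gh; apply/funext => p; apply: hK => U V /cg nU /ch nV.
have nUV : nbhs p (g @^-1` U `&` h @^-1` V) by exact: filterI.
have : closure (range (@sc_unit D)) p by rewrite sc_unit_dense.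
move=> /(_ _ nUV)[_ [[x _ <-] [Ux Vx]]].
by exists (g (sc_unit x)); split=> //; rewrite gh.
Qed.

Lemma sc_map_unique (D E : Type) (f : D -> E)
    (g : stone_cech D -> stone_cech E) :
  continuous g -> (forall x, g (sc_unit x) = sc_unit (f x)) -> g = sc_map f.
Proof.
move=> cg gf; apply: sc_ext_unique => //.
- exact: stone_cech_hausdorff.
- exact: sc_map_continuous.
- by move=> x; rewrite gf sc_map_unit.
Qed.

Lemma stone_cech_universal (D : Type) (K : topologicalType) (f : D -> K) :
  hausdorff_space K -> compact [set: K] ->
  exists! g : stone_cech D -> K,
    continuous g /\ (forall x, g (sc_unit x) = f x).
Proof.
move=> hK cK.
have cvgf (p : stone_cech D) : exists y : K, nbhs y `<=` fmap f p.
  have := cK; rewrite compact_ultra => /(_ _ (sc_map_subproof f p)).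
  by move=> /(_ (sc_filterT p))[y [_ py]]; exists y => U /py.
pose g p := projT1 (cid (cvgf p)).
have gP p : nbhs (g p) `<=` fmap f p by rewrite /g; case: cid.
have cg : continuous g.
  move=> p U /= gU.
  have [V gV VU] := @compact_regular K (g p) setT hK cK filterT U gU.
  apply/sc_nbhsP; exists (f @^-1` V); first exact: (gP p _ gV).
  move=> q qV; apply: VU => W /(gP q) qW; have qVW := sc_filterI qV qW.
  have [I0|/set0P[x [Vx Wx]]] := eqVneq ((f @^-1` V) `&` (f @^-1` W)) set0.
    by move: qVW; rewrite I0 => /sc_filter0.
  by exists (f x).
have gf x : g (sc_unit x) = f x.
  apply/esym/hK => U V nU /(gP (sc_unit x))/sc_unitE Vfx.
  by exists (f x); split=> //; exact: nbhs_singleton.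
exists g; split=> // h [ch hf]; apply: sc_ext_unique => // x.
by rewrite gf hf.
Qed.

Definition local_homeomorphism (S T : topologicalType) (f : S -> T) : Prop :=
  forall x, exists U : set S,
    [/\ open U, U x, open (f @` U), {within U, continuous f} &
        exists g : T -> S,
          {within f @` U, continuous g} /\ (forall y, U y -> g (f y) = y)].

(* A groupoid is given by its arrows A, its objects O (identified with the
   units by u), and its range, source, unit, inverse and product maps; a and b
   are composable when s a = r b. *)

Definition composable (O A : Type) (r s : A -> O) : set (A * A) :=
  [set ab | s ab.1 = r ab.2].

Definition cpair (O A : Type) (r s : A -> O) (a b : A) (h : s a = r b) :
  composable r s := SigSub (mem_set (h : composable r s (a, b))).

Record is_groupoid (O A : Type) (r s : A -> O) (u : O -> A) (i : A -> A)
    (m : composable r s -> A) : Prop := IsGroupoid {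
  grpd_r_unit : forall x, r (u x) = x;
  grpd_s_unit : forall x, s (u x) = x;
  grpd_r_inv : forall a, r (i a) = s a;
  grpd_s_inv : forall a, s (i a) = r a;
  grpd_r_mul : forall a b (h : s a = r b), r (m (cpair h)) = r a;
  grpd_s_mul : forall a b (h : s a = r b), s (m (cpair h)) = s b;
  grpd_mulA : forall a b c (hab : s a = r b) (hbc : s b = r c)
      (hl : s (m (cpair hab)) = r c) (hr : s a = r (m (cpair hbc))),
    m (cpair hl) = m (cpair hr);
  grpd_mul1l : forall a (h : s (u (r a)) = r a), m (cpair h) = a;
  grpd_mul1r : forall a (h : s a = r (u (s a))), m (cpair h) = a;
  grpd_mulVr : forall a (h : s a = r (i a)), m (cpair h) = u (r a);
  grpd_mulVl : forall a (h : s (i a) = r a), m (cpair h) = u (s a) }.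
Arguments is_groupoid {O A} r s u i m.

Record is_topological_groupoid (O A : topologicalType) (r s : A -> O)
    (u : O -> A) (i : A -> A) (m : composable r s -> A) : Prop :=
  IsTopologicalGroupoid {
  tgrpd_groupoid : is_groupoid r s u i m;
  tgrpd_r : continuous r;
  tgrpd_s : continuous s;
  tgrpd_u : continuous u;
  tgrpd_i : continuous i;
  tgrpd_m : continuous m }.
Arguments is_topological_groupoid {O A} r s u i m.

Record is_etale_groupoid (O A : topologicalType) (r s : A -> O)
    (u : O -> A) (i : A -> A) (m : composable r s -> A) : Prop :=
  IsEtaleGroupoid {
  etale_topological : is_topological_groupoid r s u i m;
  etale_r : local_homeomorphism r;
  etale_s : local_homeomorphism s }.
Arguments is_etale_groupoid {O A} r s u i m.

Record right_action (Gamma : groupType) (X : Type) := RightAction {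
  ract :> X -> Gamma -> X;
  ract1 : forall x, ract x 1%g = x;
  ractM : forall x g h, ract x (g * h)%g = ract (ract x g) h }.

Definition orbit_rel (Gamma : groupType) (X : Type)
    (act : right_action Gamma X) : rel X :=
  fun x y => `[< exists g, act x g = y >].

Lemma orbit_rel_refl (Gamma : groupType) (X : Type)
  (act : right_action Gamma X) : reflexive (orbit_rel act).
Proof. by move=> x; apply/asboolP; exists 1%g; rewrite ract1. Qed.

Lemma orbit_rel_sym (Gamma : groupType) (X : Type)
  (act : right_action Gamma X) : symmetric (orbit_rel act).
Proof.
move=> x y; apply/asboolP/asboolP => -[g <-]; exists (g^-1)%g;
  by rewrite -ractM mulgV ract1.
Qed.

Lemma orbit_rel_trans (Gamma : groupType) (X : Type)
  (act : right_action Gamma X) : transitive (orbit_rel act).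
Proof.
move=> y x z /asboolP[g <-] /asboolP[h <-]; apply/asboolP.
by exists (g * h)%g; rewrite ractM.
Qed.

Definition orbit_equiv (Gamma : groupType) (X : choiceType)
    (act : right_action Gamma X) : equiv_rel X :=
  EquivRel (orbit_rel act) (@orbit_rel_refl _ _ act) (@orbit_rel_sym _ _ act)
    (@orbit_rel_trans _ _ act).

Definition orbits (Gamma : groupType) (X : choiceType)
    (act : right_action Gamma X) : Type := {eq_quot (orbit_equiv act)}.

Definition orb (Gamma : groupType) (X : choiceType)
    (act : right_action Gamma X) (x : X) : orbits act :=
  \pi_({eq_quot (orbit_equiv act)})%qT x.

Definition orb_repr (Gamma : groupType) (X : choiceType)
    (act : right_action Gamma X) (q : orbits act) : X :=
  repr (q : {eq_quot (orbit_equiv act)}).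

Lemma orb_reprK (Gamma : groupType) (X : choiceType)
  (act : right_action Gamma X) (q : orbits act) : orb act (orb_repr q) = q.
Proof. exact: reprK. Qed.

Lemma orb_eqP (Gamma : groupType) (X : choiceType)
  (act : right_action Gamma X) (x y : X) :
  orb act x = orb act y <-> exists g, act x g = y.
Proof.
split=> [/eqP|xy]; first by rewrite /orb piE => /asboolP.
by apply/eqP; rewrite /orb piE; apply/asboolP.
Qed.

Definition diag_ract (Gamma : groupType) (X : Type)
    (act : right_action Gamma X) (xy : X * X) (g : Gamma) : X * X :=
  (act xy.1 g, act xy.2 g).

Lemma diag_ract1 (Gamma : groupType) (X : Type)
  (act : right_action Gamma X) xy : diag_ract act xy 1%g = xy.
Proof. by case: xy => x y; rewrite /diag_ract /= !ract1. Qed.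

Lemma diag_ractM (Gamma : groupType) (X : Type)
  (act : right_action Gamma X) xy g h :
  diag_ract act xy (g * h)%g = diag_ract act (diag_ract act xy g) h.
Proof. by rewrite /diag_ract /= !ractM. Qed.

Definition diag_action (Gamma : groupType) (X : Type)
    (act : right_action Gamma X) : right_action Gamma (X * X)%type :=
  RightAction (@diag_ract1 _ _ act) (@diag_ractM _ _ act).

Definition uniformly_discrete (R : realType) (X : metricType R) : Prop :=
  exists2 e : R, 0 < e & forall x y : X, x <> y -> e <= mdist x y.

Definition bounded_geometry (R : realType) (X : metricType R) : Prop :=
  forall t : R, 0 <= t ->
    exists n : nat, forall x : X, [set y | mdist x y <= t] #<= `I_n.

Definition isometric_action (R : realType) (X : metricType R)
    (Gamma : groupType) (act : right_action Gamma X) : Prop :=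
  forall x y g, mdist (act x g) (act y g) = mdist x y.

Definition free_action (Gamma : groupType) (X : Type)
    (act : right_action Gamma X) : Prop :=
  forall x g, act x g = x -> g = 1%g.

(* Gamma is discrete, so a compact set of group elements is a finite one. *)
Definition proper_action (R : realType) (X : metricType R)
    (Gamma : groupType) (act : right_action Gamma X) : Prop :=
  forall K : set X, compact K ->
    finite_set [set g : Gamma | ((act^~ g @` K) `&` K) !=set0].

Definition Delta_mod (R : realType) (X : metricType R) (Gamma : groupType)
    (act : right_action Gamma X) (t : R) : set (orbits (diag_action act)) :=
  orb (diag_action act) @` [set xy | mdist xy.1 xy.2 <= t].
Arguments Delta_mod {R X Gamma} act t _.

Definition Delta_closure (R : realType) (X : metricType R) (Gamma : groupType)
    (act : right_action Gamma X) (t : R) :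
    set (stone_cech (orbits (diag_action act))) :=
  closure (@sc_unit _ @` Delta_mod act t).
Arguments Delta_closure {R X Gamma} act t _.

(* As a type, coarse_groupoid act carries the subspace topology. *)
Definition coarse_groupoid (R : realType) (X : metricType R)
    (Gamma : groupType) (act : right_action Gamma X) :
    set (stone_cech (orbits (diag_action act))) :=
  \bigcup_(t in [set t : R | 0 <= t]) Delta_closure act t.
Arguments coarse_groupoid {R X Gamma} act _.

(* The maps of orbit spaces are computed on representatives; [orb_fstE],
   [orb_sndE], [orb_swapE] and [orb_diagE] show that they are induced by
   (x, y) |-> x, (x, y) |-> y, (x, y) |-> (y, x) and x |-> (x, x). *)
Definition orb_fst (Gamma : groupType) (X : choiceType)
    (act : right_action Gamma X) (q : orbits (diag_action act)) : orbits act :=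
  orb act (orb_repr q).1.
Arguments orb_fst {Gamma X} act _.

Definition orb_snd (Gamma : groupType) (X : choiceType)
    (act : right_action Gamma X) (q : orbits (diag_action act)) : orbits act :=
  orb act (orb_repr q).2.
Arguments orb_snd {Gamma X} act _.

Definition orb_swap (Gamma : groupType) (X : choiceType)
    (act : right_action Gamma X) (q : orbits (diag_action act)) :
    orbits (diag_action act) :=
  orb (diag_action act) ((orb_repr q).2, (orb_repr q).1).
Arguments orb_swap {Gamma X} act _.

Definition orb_diag (Gamma : groupType) (X : choiceType)
    (act : right_action Gamma X) (q : orbits act) :
    orbits (diag_action act) :=
  orb (diag_action act) (orb_repr q, orb_repr q).
Arguments orb_diag {Gamma X} act _.

Lemma orb_fstE (Gamma : groupType) (X : choiceType)
  (act : right_action Gamma X) (x y : X) :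
  orb_fst act (orb (diag_action act) (x, y)) = orb act x.
Proof.
have /orb_eqP[g] := orb_reprK (orb (diag_action act) (x, y)).
rewrite /orb_fst; case: (orb_repr _) => x' y' /=; rewrite /diag_ract /= => -[gx gy].
by apply/orb_eqP; exists g.
Qed.

Lemma orb_sndE (Gamma : groupType) (X : choiceType)
  (act : right_action Gamma X) (x y : X) :
  orb_snd act (orb (diag_action act) (x, y)) = orb act y.
Proof.
have /orb_eqP[g] := orb_reprK (orb (diag_action act) (x, y)).
rewrite /orb_snd; case: (orb_repr _) => x' y' /=; rewrite /diag_ract /= => -[gx gy].
by apply/orb_eqP; exists g.
Qed.

Lemma orb_swapE (Gamma : groupType) (X : choiceType)
  (act : right_action Gamma X) (x y : X) :
  orb_swap act (orb (diag_action act) (x, y)) = orb (diag_action act) (y, x).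
Proof.
have /orb_eqP[g] := orb_reprK (orb (diag_action act) (x, y)).
rewrite /orb_swap; case: (orb_repr _) => x' y' /=; rewrite /diag_ract /= => -[gx gy].
by apply/orb_eqP; exists g; rewrite /= /diag_ract /= gx gy.
Qed.

Lemma orb_diagE (Gamma : groupType) (X : choiceType)
  (act : right_action Gamma X) (x : X) :
  orb_diag act (orb act x) = orb (diag_action act) (x, x).
Proof.
have /orb_eqP[g gx] := orb_reprK (orb act x).
by apply/orb_eqP; exists g; rewrite /= /diag_ract /= gx.
Qed.

Definition cg_range (R : realType) (X : metricType R) (Gamma : groupType)
    (act : right_action Gamma X) (a : coarse_groupoid act) :
    stone_cech (orbits act) :=
  sc_map (orb_fst act) (\val a).
Arguments cg_range {R X Gamma} act _.

Definition cg_source (R : realType) (X : metricType R) (Gamma : groupType)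
    (act : right_action Gamma X) (a : coarse_groupoid act) :
    stone_cech (orbits act) :=
  sc_map (orb_snd act) (\val a).
Arguments cg_source {R X Gamma} act _.

Lemma cg_inv_subproof (R : realType) (X : metricType R) (Gamma : groupType)
  (act : right_action Gamma X) (a : coarse_groupoid act) :
  coarse_groupoid act (sc_map (orb_swap act) (\val a)).
Proof.
case: a => a /= /set_mem[t t0 /sc_closureP at_]; exists t => //.
apply/sc_closureP; apply: sc_filterS at_ => _ [[x y] xyt <-] /=.
by rewrite orb_swapE; exists (y, x) => //=; rewrite metric_sym.
Qed.

Definition cg_inv (R : realType) (X : metricType R) (Gamma : groupType)
    (act : right_action Gamma X) (a : coarse_groupoid act) :
    coarse_groupoid act :=
  SigSub (mem_set (cg_inv_subproof a)).
Arguments cg_inv {R X Gamma} act _.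

Lemma cg_unit_subproof (R : realType) (X : metricType R) (Gamma : groupType)
  (act : right_action Gamma X) (p : stone_cech (orbits act)) :
  coarse_groupoid act (sc_map (orb_diag act) p).
Proof.
exists 0 => //=; apply/sc_closureP; apply: sc_filterS (sc_filterT p) => q _ /=.
by exists (orb_repr q, orb_repr q) => //=; rewrite mdistxx.
Qed.

Definition cg_unit (R : realType) (X : metricType R) (Gamma : groupType)
    (act : right_action Gamma X) (p : stone_cech (orbits act)) :
    coarse_groupoid act :=
  SigSub (mem_set (cg_unit_subproof p)).
Arguments cg_unit {R X Gamma} act _.

Lemma cg_arrow_subproof (R : realType) (X : metricType R) (Gamma : groupType)
  (act : right_action Gamma X) (x y : X) :
  coarse_groupoid act (sc_unit (orb (diag_action act) (x, y))).
Proof.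
exists (mdist x y) => /=; first exact: mdist_ge0.
by apply/subset_closure; exists (orb (diag_action act) (x, y)) => //;
  exists (x, y) => /=.
Qed.

(* [x, y] as an element of the groupoid *)
Definition cg_arrow (R : realType) (X : metricType R) (Gamma : groupType)
    (act : right_action Gamma X) (x y : X) : coarse_groupoid act :=
  SigSub (mem_set (cg_arrow_subproof act x y)).

(* m is, for all t1 and t2, the continuous extension of
   [x, y] o [y g, z] = [x, z g^-1] from the composable pairs of
   Delta_t1 / Gamma and Delta_t2 / Gamma to those of their closures. *)
Definition is_composition (R : realType) (X : metricType R)
    (Gamma : groupType) (act : right_action Gamma X)
    (m : composable (cg_range act) (cg_source act) ->
         coarse_groupoid act) : Prop :=
  forall t1 t2 : R, 0 <= t1 -> 0 <= t2 ->
    {within [set ab : composable (cg_range act) (cg_source act) |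
              Delta_closure act t1 (\val (\val ab).1) /\
              Delta_closure act t2 (\val (\val ab).2)], continuous m} /\
    (forall (x y z : X) (g : Gamma)
       (h : cg_source act (cg_arrow act x y) = cg_range act (cg_arrow act (act y g) z)),
       mdist x y <= t1 -> mdist (act y g) z <= t2 ->
       m (cpair h) = cg_arrow act x (act z g^-1%g)).
Arguments is_composition {R X Gamma} act m.

(* Main.v *)
Require Import Defs.
From HB Require Import structures.
From mathcomp Require Import all_boot all_order all_algebra.
From mathcomp Require Import all_classical all_reals topology.

Set Implicit Arguments.
Unset Strict Implicit.
Unset Printing Implicit Defensive.

Import Order.TTheory GRing.Theory Num.Theory.
Local Open Scope classical_set_scope.
Local Open Scope ring_scope.

(* For composable ultrafilters p and q, the sets containing a product A.B with
   A in p and B in q form a filter; this is p o q, and with this description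
   continuity and the groupoid laws reduce to those of the discrete partial
   operation on orbits. Bounded geometry enters once: it splits Delta_t / Gamma
   into finitely many pieces on which the range (or source) is injective, so
   that each ultrafilter on it contains such a piece. This makes p o q an
   ultrafilter, and it makes r and s homeomorphisms from the closure of a piece
   to the closure of its image, both of which are open. *)

(** * Ultrafilters, sections and subspace neighbourhoods *)

Lemma ultra_of_setVsetC (T : Type) (F : set_system T) :
  ProperFilter F -> (forall A, F A \/ F (~` A)) -> UltraFilter F.
Proof.
move=> FF FC; split=> // G GF FG; rewrite eqEsubset; split=> // A GA.
have [//|/FG GnA] := FC A.
have : G (A `&` ~` A) by exact: filterI.
by rewrite setICr => /filter_not_empty.
Qed.

Lemma sc_filter_ex (D : Type) (p : stone_cech D) (A : set D) :
  p A -> A !=set0.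
Proof.
by move=> pA; apply/set0P/negP => /eqP A0; move: pA; rewrite A0 => /sc_filter0.
Qed.

(** Induction on the number of colours: the ultrafilter contains the last colour class or its
    complement, which leaves one colour fewer. *)
Lemma sc_filter_fiber (D : Type) (p : stone_cech D) (k : D -> nat) (n : nat) :
  p [set x | (k x < n)%N] -> exists i, p (k @^-1` [set i]).
Proof.
elim: n => [|n IHn] pn; first by have [x] := sc_filter_ex pn.
have [pkn|pkn] := sc_filterC p (k @^-1` [set n]); first by exists n.
apply: IHn; apply: sc_filterS (sc_filterI pn pkn) => x /= [].
by rewrite ltnS leq_eqVlt => /orP[/eqP|].
Qed.

(** With source and range for [f] and [g], this says that [p]-almost every arrow has a composable
    partner in [B]. *)
Lemma sc_map_eq_image (D E O : Type) (f : D -> O) (g : E -> O)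
    (p : stone_cech D) (q : stone_cech E) (B : set E) :
  sc_map f p = sc_map g q -> q B -> p (f @^-1` (g @` B)).
Proof.
move=> pq qB; have : sc_map g q (g @` B).
  by apply: sc_filterS qB => x Bx; exists x.
by rewrite -pq.
Qed.

(** The point [a0] is the value of [g] off the image of [A], so that [g] carries every ultrafilter
    on [E] to one containing [A]. *)
Lemma inj_section (D E : Type) (f : D -> E) (A : set D) (a0 : D) :
  A a0 -> set_inj A f ->
  exists g : E -> D, (forall e, A (g e)) /\ (forall a, A a -> g (f a) = a).
Proof.
move=> Aa0 finj.
have /choice[g gP] : forall e, exists d, A d /\ (forall a, A a -> f a = e -> d = a).
  move=> e; have [[a Aa fae]|nA] := pselect (exists2 a, A a & f a = e).
    exists a; split=> // b Ab fbe; apply: finj; rewrite ?inE //.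
    by rewrite fae fbe.
  by exists a0; split=> // a Aa fae; case: nA; exists a.
exists g; split=> [e|a Aa]; first by have [] := gP e.
by have [_ /(_ a)->] := gP (f a).
Qed.

Lemma set_type_nbhsP (T : topologicalType) (G : set T) (x : G) (U : set G) :
  nbhs x U <-> exists2 V : set T, nbhs (\val x) V & \val @^-1` V `<=` U.
Proof.
split=> [[_ /= [[V oV <-] Vx VU]]|[V Vx VU]].
  by exists V => //; exact: open_nbhs_nbhs.
apply: filterS VU _; exact: (@initial_continuous G T set_val x V Vx).
Qed.

(** * The partial composition of orbits of pairs *)

Section OrbitComposition.
Context (Gamma : groupType) (X : choiceType) (act : right_action Gamma X).
Local Notation orb2 := (orb (diag_action act)).
Local Notation Q := (orbits (diag_action act)).

(** Kept as a relation: the product is partial, and its independence of representatives rests on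
    freeness. *)
Definition orb_comp (a b c : Q) : Prop :=
  exists x y z, [/\ a = orb2 (x, y), b = orb2 (y, z) & c = orb2 (x, z)].

Lemma orb2_act (x y : X) (g : Gamma) : orb2 (act x g, act y g) = orb2 (x, y).
Proof. by apply/esym/orb_eqP; exists g. Qed.

Lemma orb2_eqP (x y x' y' : X) :
  orb2 (x, y) = orb2 (x', y') <-> exists2 g, act x g = x' & act y g = y'.
Proof.
rewrite orb_eqP; split=> [[g [gx gy]]|[g gx gy]]; exists g => //.
by rewrite /= /diag_ract /= gx gy.
Qed.

Lemma orb2_fst_repr (x : X) (a : Q) :
  orb_fst act a = orb act x -> exists y, a = orb2 (x, y).
Proof.
rewrite -[a]orb_reprK; case: (orb_repr a) => x' y'.
by rewrite orb_fstE => /orb_eqP[g <-]; exists (act y' g); rewrite orb2_act.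
Qed.

Lemma ractK (x : X) (g : Gamma) : act (act x g) g^-1%g = x.
Proof. by rewrite -ractM mulgV ract1. Qed.

(** Translating the second pair by [g^-1] gives both pairs the middle point [y]. *)
Lemma orb_compE (x y z : X) (g : Gamma) :
  orb_comp (orb2 (x, y)) (orb2 (act y g, z)) (orb2 (x, act z g^-1%g)).
Proof.
exists x, y, (act z g^-1%g); split=> //.
by rewrite -(orb2_act _ _ g^-1%g) ractK.
Qed.

Lemma orb_comp_ex (a b : Q) :
  orb_snd act a = orb_fst act b -> exists c, orb_comp a b c.
Proof.
rewrite -[a]orb_reprK; case: (orb_repr a) => x y.
rewrite orb_sndE => /esym/orb2_fst_repr[z ->].
by exists (orb2 (x, z)), x, y, z.
Qed.

Lemma orb_comp_composable (a b c : Q) :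
  orb_comp a b c -> orb_snd act a = orb_fst act b.
Proof. by case=> x [y [z [-> -> _]]]; rewrite orb_sndE orb_fstE. Qed.

Lemma orb_comp_fst (a b c : Q) :
  orb_comp a b c -> orb_fst act c = orb_fst act a.
Proof. by case=> x [y [z [-> _ ->]]]; rewrite !orb_fstE. Qed.

Lemma orb_comp_snd (a b c : Q) :
  orb_comp a b c -> orb_snd act c = orb_snd act b.
Proof. by case=> x [y [z [_ -> ->]]]; rewrite !orb_sndE. Qed.

(** Two choices of representatives differ by some [g] on the first pair and [h] on the second; both
    carry [y] to the same point, so freeness gives [h = g]. *)
Lemma orb_comp_inj (a b c c' : Q) : free_action act ->
  orb_comp a b c -> orb_comp a b c' -> c = c'.
Proof.
move=> free [x [y [z [-> -> ->]]]] [x' [y' [z' []]]].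
move=> /orb2_eqP[g <- gy] /orb2_eqP[h hy <-] ->; apply/esym.
suff -> : h = g by exact: orb2_act.
have /free hg : act y (h * g^-1)%g = y.
  by rewrite ractM hy -gy ractK.
by rewrite -[h]mulg1 -(mulVg g) mulgA hg mul1g.
Qed.

Lemma orb_compA (a b c d e : Q) :
  orb_comp b c d -> orb_comp a d e ->
  exists2 f, orb_comp a b f & orb_comp f c e.
Proof.
case=> y [z [w [-> -> ->]]] [x [y' [w' [-> /orb2_eqP[g <- <-] ->]]]].
(* The two representatives of [d] differ by [g]; once [x] is written as a translate by [g], this [g]
   cancels in each pair. *)
have -> : x = act (act x g^-1%g) g by rewrite -ractM mulVg ract1.
move: (act x g^-1%g) => {}x; rewrite !orb2_act.
by exists (orb2 (x, z)); [exists x, y, z | exists x, z, w].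
Qed.

Lemma orb_comp1l (a : Q) : orb_comp (orb_diag act (orb_fst act a)) a a.
Proof.
rewrite -[a]orb_reprK; case: (orb_repr a) => x y.
by rewrite orb_fstE orb_diagE; exists x, x, y.
Qed.

Lemma orb_comp1r (a : Q) : orb_comp a (orb_diag act (orb_snd act a)) a.
Proof.
rewrite -[a]orb_reprK; case: (orb_repr a) => x y.
by rewrite orb_sndE orb_diagE; exists x, y, y.
Qed.

Lemma orb_compVr (a : Q) :
  orb_comp a (orb_swap act a) (orb_diag act (orb_fst act a)).
Proof.
rewrite -[a]orb_reprK; case: (orb_repr a) => x y.
by rewrite orb_fstE orb_diagE orb_swapE; exists x, y, x.
Qed.

Lemma orb_compVl (a : Q) :
  orb_comp (orb_swap act a) a (orb_diag act (orb_snd act a)).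
Proof.
rewrite -[a]orb_reprK; case: (orb_repr a) => x y.
by rewrite orb_sndE orb_diagE orb_swapE; exists y, x, y.
Qed.

Lemma orb_swapK (a : Q) : orb_swap act (orb_swap act a) = a.
Proof.
by rewrite -[a]orb_reprK; case: (orb_repr a) => x y; rewrite !orb_swapE.
Qed.

Lemma orb_fst_swap (a : Q) : orb_fst act (orb_swap act a) = orb_snd act a.
Proof.
by rewrite -[a]orb_reprK; case: (orb_repr a) => x y;
  rewrite orb_swapE orb_fstE orb_sndE.
Qed.

Lemma orb_snd_swap (a : Q) : orb_snd act (orb_swap act a) = orb_fst act a.
Proof. by rewrite -orb_fst_swap orb_swapK. Qed.

Lemma orb_fst_diag (o : orbits act) : orb_fst act (orb_diag act o) = o.
Proof. by rewrite -[o]orb_reprK orb_diagE orb_fstE. Qed.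

Lemma orb_snd_diag (o : orbits act) : orb_snd act (orb_diag act o) = o.
Proof. by rewrite -[o]orb_reprK orb_diagE orb_sndE. Qed.

Definition set_comp (A B : set Q) : set Q :=
  [set c | exists a b, [/\ A a, B b & orb_comp a b c]].

Lemma set_comp_subset (A B A' B' : set Q) :
  A `<=` A' -> B `<=` B' -> set_comp A B `<=` set_comp A' B'.
Proof. by move=> AA BB c [a [b [/AA Aa /BB Bb abc]]]; exists a, b. Qed.

Definition comp_filter (p q : stone_cech Q) : set_system Q :=
  [set C | exists A B, [/\ p A, q B & set_comp A B `<=` C]].

(* Where [orb_fst] is injective, a determines the b composable with it and so,
   by freeness, the composite c. Hence the a whose composite lies in C and
   those whose composite does not are complementary, and p decides C. *)
Lemma comp_filter_ultra (p q : stone_cech Q) : free_action act ->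
  sc_map (orb_snd act) p = sc_map (orb_fst act) q ->
  (exists2 B, q B & set_inj B (orb_fst act)) ->
  UltraFilter (comp_filter p q).
Proof.
move=> free pq [B0 qB0 injB0].
apply: ultra_of_setVsetC.
  split.
    case=> A [B [pA qB AB]].
    (* Since [p] and [q] are composable, some [a] in [A] meets a composable [b] in [B], so no
       product is empty. *)
    have [a [Aa [b Bb ba]]] :=
      sc_filter_ex (sc_filterI pA (sc_map_eq_image pq qB)).
    by have [c abc] := orb_comp_ex (esym ba); apply: (AB c); exists a, b.
  split=> [|C C' [A [B [pA qB AB]]] [A' [B' [pA' qB' AB']]]|C C' CC' [A [B [pA qB AB]]]].
  - by exists setT, setT; split=> //; exact: sc_filterT.
  - exists (A `&` A'), (B `&` B'); split; [exact: sc_filterI..|].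
    move=> c cAB; split; [apply: AB|apply: AB'];
      exact: set_comp_subset cAB.
  - by exists A, B; split=> //; exact: subset_trans CC'.
move=> C.
pose A := [set a | exists b c, [/\ B0 b, C c & orb_comp a b c]].
have [pA|pA] := sc_filterC p A; [left; exists A, B0|right; exists (~` A), B0].
  split=> // c [a [b [[b' [c' [Bb' Cc' abc']]] Bb abc]]].
  have bb' : b' = b.
    apply: injB0; rewrite ?inE //.
    by rewrite -(orb_comp_composable abc) -(orb_comp_composable abc').
  by rewrite bb' in abc'; rewrite (orb_comp_inj free abc abc').
by split=> // c [a [b [nAa Bb abc]]] Cc; apply: nAa; exists b, c.
Qed.

End OrbitComposition.

(** * Pieces of bounded width on which range or source is injective *)

Section LocalInjectivity.
Context (R : realType) (X : metricType R) (Gamma : groupType).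
Context (act : right_action Gamma X).
Context (act_isometric : isometric_action act).
Local Notation orb2 := (orb (diag_action act)).
Local Notation Q := (orbits (diag_action act)).

(** An isometric action makes the distance a function on orbits of pairs. *)
Lemma Delta_modE (t : R) (x y : X) :
  Delta_mod act t (orb2 (x, y)) <-> mdist x y <= t.
Proof.
split=> [[[x' y'] /= xyt /orb2_eqP[g <- <-]]|xyt]; last by exists (x, y).
by rewrite act_isometric.
Qed.

Lemma Delta_mod_swap (t : R) (a : Q) :
  Delta_mod act t (orb_swap act a) <-> Delta_mod act t a.
Proof.
rewrite -[a]orb_reprK; case: (orb_repr a) => x y.
by rewrite orb_swapE !Delta_modE metric_sym.
Qed.

Lemma Delta_mod_comp (t1 t2 : R) (a b c : Q) :
  Delta_mod act t1 a -> Delta_mod act t2 b -> orb_comp a b c ->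
  Delta_mod act (t1 + t2) c.
Proof.
move=> at_ bt [x [y [z [ea eb ->]]]]; move: at_ bt.
rewrite ea eb !Delta_modE => xy yz.
by apply: le_trans (metric_triangle _ y _) _; exact: lerD.
Qed.

(* Colour [x, y] by the index of y in the ball around a chosen representative
   x of the orbit of x: finitely many colours, each of them injective. *)
Lemma Delta_mod_fst_inj (t : R) (p : stone_cech Q) :
  bounded_geometry X -> 0 <= t -> p (Delta_mod act t) ->
  exists A, [/\ p A, A `<=` Delta_mod act t & set_inj A (orb_fst act)].
Proof.
move=> bg t0 pt; have [n ballX] := bg t t0.
have /choice[f fP] : forall x : X, exists f : X -> nat,
    (forall y, mdist x y <= t -> (f y < n)%N) /\
    set_inj [set y | mdist x y <= t] f.
  move=> x; have /pcard_leP[f] := ballX x.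
  by exists f; split=> [y xy|]; [exact: (@funS _ _ _ _ f) | exact: inj].
have /choice[y yP] : forall a : Q, exists y,
    a = orb2 (orb_repr (orb_fst act a), y).
  by move=> a; apply: orb2_fst_repr; rewrite orb_reprK.
pose x a := orb_repr (orb_fst act a).
have xyt a : Delta_mod act t a -> mdist (x a) (y a) <= t.
  by rewrite [a in Delta_mod act t a]yP Delta_modE.
have : p [set a | (f (x a) (y a) < n)%N].
  by apply: sc_filterS pt => a /xyt; have [fn _] := fP (x a); exact: fn.
move=> /sc_filter_fiber[i pi].
exists (Delta_mod act t `&` (fun a => f (x a) (y a)) @^-1` [set i]).
split; [exact: sc_filterI | by move=> a [] |].
move=> a b; rewrite !inE => -[at_ /= ai] [bt bi] ab.
have xab : x b = x a by rewrite /x ab.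
suff yab : y a = y b by rewrite (yP a) (yP b) -ab yab.
have [_ finj] := fP (x a); apply: finj; rewrite ?inE /=.
- exact: xyt.
- by rewrite -xab; exact: xyt.
- by rewrite ai -bi xab.
Qed.

(** The swap exchanges range and source and preserves width, which reduces this to the case of the
    range. *)
Lemma Delta_mod_snd_inj (t : R) (p : stone_cech Q) :
  bounded_geometry X -> 0 <= t -> p (Delta_mod act t) ->
  exists A, [/\ p A, A `<=` Delta_mod act t & set_inj A (orb_snd act)].
Proof.
move=> bg t0 pt.
have : sc_map (orb_swap act) p (Delta_mod act t).
  by apply: sc_filterS pt => a /=; rewrite Delta_mod_swap.
move=> /(Delta_mod_fst_inj bg t0)[A [pA At Ainj]].
exists (orb_swap act @^-1` A); split=> // [a /At|a b].
  by rewrite Delta_mod_swap.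
rewrite !inE => aA bA ab; apply: (can_inj (@orb_swapK _ _ act)).
by apply: Ainj; rewrite ?inE // !orb_fst_swap.
Qed.

End LocalInjectivity.

(** * Topology of the groupoid and its local homeomorphisms *)

Section CoarseGroupoid.
Context (R : realType) (X : metricType R) (Gamma : groupType).
Context (act : right_action Gamma X).
Local Notation orb2 := (orb (diag_action act)).
Local Notation Q := (orbits (diag_action act)).
Local Notation G := (coarse_groupoid act).
Local Notation G2 := (composable (cg_range act) (cg_source act)).

Lemma coarse_groupoidP (p : stone_cech Q) :
  G p <-> exists2 t : R, 0 <= t & p (Delta_mod act t).
Proof.
by split=> [[t t0 /sc_closureP pt]|[t t0 pt]]; exists t => //; apply/sc_closureP.
Qed.

Lemma cg_valP (a : G) : exists2 t : R, 0 <= t & \val a (Delta_mod act t).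
Proof. by apply/coarse_groupoidP/set_mem/valP. Qed.

Lemma cg_nbhsP (a : G) (U : set G) :
  nbhs a U <-> exists2 A, \val a A & [set b : G | \val b A] `<=` U.
Proof.
split=> [/set_type_nbhsP[V /sc_nbhsP[A aA AV] VU]|[A aA AU]].
  by exists A => // b bA; apply: VU; exact: AV.
by apply/set_type_nbhsP; exists (sc_basic A) => //; apply/sc_nbhsP; exists A.
Qed.

Lemma cg_continuousP (T : topologicalType) (f : T -> G) :
  continuous (fun x => \val (f x)) -> continuous f.
Proof. by move=> cf; exact: continuous_comp_initial cf. Qed.

Lemma cg_val_continuous : continuous (fun a : G => \val a).
Proof. exact: initial_continuous. Qed.

Lemma cg_map_continuous (E : Type) (f : Q -> E) :
  continuous (fun a : G => sc_map f (\val a)).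
Proof.
move=> a; apply: (continuous_comp (@cg_val_continuous a)).
exact: sc_map_continuous.
Qed.

(** These boxes match the generators of [comp_filter], which is what will make the product
    continuous. *)
Lemma composable_nbhsP (ab : G2) (U : set G2) :
  nbhs ab U <-> exists A B, [/\ \val (\val ab).1 A, \val (\val ab).2 B &
    [set cd : G2 | \val (\val cd).1 A /\ \val (\val cd).2 B] `<=` U].
Proof.
split=> [/set_type_nbhsP[V [[/= V1 V2] []]]|[A [B [aA bB ABU]]]].
  move=> /cg_nbhsP[A aA AV1] /cg_nbhsP[B bB BV2] V12 VU.
  exists A, B; split=> // cd [cA dB]; apply/VU/V12.
  by split; [exact: AV1 | exact: BV2].
apply/set_type_nbhsP.
exists ([set c : G | \val c A] `*` [set d : G | \val d B]); last first.
  by move=> cd; apply: ABU.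
by exists ([set c : G | \val c A], [set d : G | \val d B]) => //=; split; apply/cg_nbhsP;
  [exists A | exists B].
Qed.

(** On the arrows containing [A], the inverse is the continuous extension of a section [g] of [f]
    over [A]. *)
Lemma sc_map_local_homeomorphism (E : Type) (f : Q -> E) :
  (forall (t : R) (p : stone_cech Q), 0 <= t -> p (Delta_mod act t) ->
    exists A, [/\ p A, A `<=` Delta_mod act t & set_inj A f]) ->
  local_homeomorphism (fun a : G => sc_map f (\val a)).
Proof.
move=> finj a; have [t t0 at_] := cg_valP a.
have [A [aA At Ainj]] := finj t _ t0 at_.
have [a0 Aa0] := sc_filter_ex aA.
have [g [gA gf]] := inj_section Aa0 Ainj.
(* As [g] takes all its values in [A], its extension stays in the closure of width [t] even off the
   image. *)
have Gg (o : stone_cech E) : G (sc_map g o).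
  apply/coarse_groupoidP; exists t => //.
  by apply: sc_filterS (sc_filterT o) => e _ /=; exact: At.
pose h o : G := SigSub (mem_set (Gg o)).
have fh (o : stone_cech E) : o (f @` A) -> sc_map f (sc_map g o) = o.
  move=> oA; apply/esym/sc_eq => C oC.
  apply: sc_filterS (sc_filterI oC oA) => _ [/[swap] -[b Ab <-]] Cb /=.
  by rewrite gf.
exists [set b : G | \val b A]; split=> //.
- rewrite openE => b bA; apply/cg_nbhsP; by exists A.
- suff -> : [set sc_map f (\val b) | b in [set b : G | \val b A]]
      = sc_basic (f @` A) by exact: sc_basic_open.
  rewrite eqEsubset; split=> [_ [b bA <-]|o oA].
    by apply: sc_filterS bA => x Ax; exists x.
  exists (h o); last exact: fh.
  by apply: sc_filterS (sc_filterT o) => e _; exact: gA.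
- by apply: continuous_subspaceT; exact: cg_map_continuous.
exists h; split=> [|b bA].
  apply/continuous_subspaceT/cg_continuousP; exact: sc_map_continuous.
apply/val_inj/esym/sc_eq => C bC /=.
by apply: sc_filterS (sc_filterI bC bA) => x [Cx Ax] /=; rewrite gf.
Qed.

(** * The composition: existence, uniqueness and groupoid laws *)

Definition is_filter_comp (m : G2 -> G) : Prop :=
  forall ab C, \val (m ab) C <->
    comp_filter (\val (\val ab).1) (\val (\val ab).2) C.

Lemma filter_comp_ex : bounded_geometry X -> free_action act ->
  isometric_action act -> exists m, is_filter_comp m.
Proof.
move=> bg free iso.
suff /choice[m mP] : forall ab : G2, exists c : G, forall C, \val c C <->
    comp_filter (\val (\val ab).1) (\val (\val ab).2) C by exists m.
case=> -[a b] /= /set_mem ab.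
have [t1 t10 at1] := cg_valP a; have [t2 t20 bt2] := cg_valP b.
have [B [bB _ Binj]] := Delta_mod_fst_inj iso bg t20 bt2.
have U : UltraFilter (comp_filter (\val a) (\val b)).
  by apply: comp_filter_ultra => //; exists B.
have Gc : G (StoneCech U).
  (* By the triangle inequality, widths add under composition. *)
  apply/coarse_groupoidP; exists (t1 + t2); first exact: addr_ge0.
  exists (Delta_mod act t1), (Delta_mod act t2); split=> //.
  by move=> c [x [y [xt yt]]]; exact: Delta_mod_comp.
by exists (SigSub (mem_set Gc)).
Qed.

(** Sets [A] and [B] witnessing that [C] belongs to one product also witness it for every pair in
    the box they define. *)
Lemma filter_comp_is_composition (m : G2 -> G) : free_action act ->
  is_filter_comp m -> continuous m /\ is_composition act m.
Proof.
move=> free mP.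
have cm : continuous m.
  move=> ab U /cg_nbhsP[C /mP[A [B [aA bB ABC]]] CU].
  apply/composable_nbhsP; exists A, B; split=> // cd [cA dB].
  by apply: CU; apply/mP; exists A, B.
split=> // t1 t2 _ _; split; first exact: continuous_subspaceT.
move=> x y z g h _ _; apply/val_inj/sc_eq => C.
move=> /mP[A [B [/sc_unitE Axy /sc_unitE Byz ABC]]]; apply/sc_unitE/ABC.
by do 2 eexists; split; [exact: Axy | exact: Byz | exact: orb_compE].
Qed.

(* The composable pairs of arrows [x, y] are dense in the composable pairs, so
   a composition is determined by its values there. *)
Lemma is_composition_unique (m m' : G2 -> G) :
  is_composition act m -> is_composition act m' -> m = m'.
Proof.
move=> mc m'c; apply/funext => ab; apply/val_inj/sc_eq => C mabC.
(* Otherwise [C] and its complement separate the two values at [ab]; by continuity they still do at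
   a nearby pair of arrows, where both compositions are prescribed. *)
have [//|m'abC] := sc_filterC (\val (m' ab)) C.
have [t1 t10 at1] := cg_valP (\val ab).1.
have [t2 t20 bt2] := cg_valP (\val ab).2.
pose S : set G2 := [set cd | Delta_closure act t1 (\val (\val cd).1) /\
  Delta_closure act t2 (\val (\val cd).2)].
have [mcont mE] : {within S, continuous m} /\ _ := mc _ _ t10 t20.
have [m'cont m'E] : {within S, continuous m'} /\ _ := m'c _ _ t10 t20.
have Sab : S ab by split; apply/sc_closureP.
have nC : nbhs (m ab) [set c : G | \val c C] by apply/cg_nbhsP; exists C.
have n'C : nbhs (m' ab) [set c : G | \val c (~` C)].
  by apply/cg_nbhsP; exists (~` C).
move/subspace_continuousP/(_ _ Sab _ nC)/composable_nbhsP : mcont.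
move=> [A [B [aA bB ABC]]].
move/subspace_continuousP/(_ _ Sab _ n'C)/composable_nbhsP : m'cont.
move=> [A' [B' [aA' bB' ABC']]].
have abE : cg_source act (\val ab).1 = cg_range act (\val ab).2.
  exact: (set_mem (valP ab)).
have pA := sc_filterI (sc_filterI aA aA') at1.
have pB := sc_filterI (sc_filterI bB bB') bt2.
have [a [[[Aa A'a] at_] [b [[Bb B'b] bt] ba]]] :=
  sc_filter_ex (sc_filterI pA (sc_map_eq_image abE pB)).
case: at_ => -[x y] /= xyt xya; case: bt => -[y' z] /= yzt yzb; subst a b.
(* Equality of the orbits of [y] and [y'] supplies the [g] of the prescribed formula. *)
have /esym/orb_eqP[g gy] : orb act y' = orb act y.
  by rewrite -(orb_fstE act y' z) -(orb_sndE act x y).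
subst y'.
have h : cg_source act (cg_arrow act x y)
    = cg_range act (cg_arrow act (act y g) z).
  by rewrite /cg_source /cg_range /= !sc_map_unit ba.
have Sh : S (cpair h).
  by split; apply/subset_closure; eexists => //; eexists => //=.
have mC : \val (m (cpair h)) C by apply: ABC => //; split; exact/sc_unitE.
have m'C : \val (m' (cpair h)) (~` C) by apply: ABC' => //; split; exact/sc_unitE.
move: mC m'C; rewrite mE // m'E // => mC m'C.
by have [c []] := sc_filter_ex (sc_filterI mC m'C).
Qed.

(** An inclusion of ultrafilters is an equality, so each law needs one inclusion, checked on orbits
    inside the witnesses [A] and [B]. *)
Lemma filter_comp_groupoid (m : G2 -> G) : is_filter_comp m ->
  is_groupoid (cg_range act) (cg_source act) (cg_unit act) (cg_inv act) m.
Proof.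
move=> mP; split.
- move=> o; apply: sc_eq => C.
  by apply: (@sc_filterS _ o) => e; rewrite /= orb_fst_diag.
- move=> o; apply: sc_eq => C.
  by apply: (@sc_filterS _ o) => e; rewrite /= orb_snd_diag.
- move=> a; apply: sc_eq => C.
  by apply: (@sc_filterS _ (\val a)) => e; rewrite /= orb_fst_swap.
- move=> a; apply: sc_eq => C.
  by apply: (@sc_filterS _ (\val a)) => e; rewrite /= orb_snd_swap.
- move=> a b h; apply: sc_eq => C /mP[A [B [aA bB ABC]]].
  apply: sc_filterS (sc_filterI aA (sc_map_eq_image h bB)) => x [Ax [y By yx]].
  have [c xyc] := orb_comp_ex (esym yx).
  by rewrite /= -(orb_comp_fst xyc); apply: ABC; exists x, y.
- move=> a b h; apply: sc_eq => C /mP[A [B [aA bB ABC]]].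
  apply: sc_filterS (sc_filterI bB (sc_map_eq_image (esym h) aA)).
  move=> y [By [x Ax xy]]; have [c xyc] := orb_comp_ex xy.
  by rewrite /= -(orb_comp_snd xyc); apply: ABC; exists x, y.
- move=> a b c hab hbc hl hr; apply/val_inj/sc_eq => E.
  move=> /mP[D [C [/mP[A [B [aA bB ABD]]] cC DCE]]]; apply/mP.
  exists A, (set_comp B C); split=> //; first by apply/mP; exists B, C; split.
  move=> e [x [yz [Ax [y [z [By Cz y_z]]] xyz]]].
  have [xy x_y xy_z] := orb_compA y_z xyz.
  by apply: DCE; exists xy, z; split=> //; apply: ABD; exists x, y.
- move=> a h; apply/val_inj/sc_eq => C /mP[A [B [aA aB ABC]]].
  (* Pulling [A] back to a set in [a] itself lets both factors be evaluated at the same orbit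
     [x]. *)
  have {}aA : \val a ((orb_diag act \o orb_fst act) @^-1` A) := aA.
  apply: sc_filterS (sc_filterI aA aB) => x [Ax Bx]; apply: ABC.
  by exists (orb_diag act (orb_fst act x)), x; split=> //; exact: orb_comp1l.
- move=> a h; apply/val_inj/sc_eq => C /mP[A [B [aA aB ABC]]].
  have {}aB : \val a ((orb_diag act \o orb_snd act) @^-1` B) := aB.
  apply: sc_filterS (sc_filterI aA aB) => x [Ax Bx]; apply: ABC.
  by exists x, (orb_diag act (orb_snd act x)); split=> //; exact: orb_comp1r.
- move=> a h; apply/val_inj/sc_eq => C /mP[A [B [aA aB ABC]]].
  have {}aB : \val a (orb_swap act @^-1` B) := aB.
  apply: (@sc_filterS _ (\val a) _ _ _ (sc_filterI aA aB)) => x [Ax Bx].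
  by apply: ABC; exists x, (orb_swap act x); split=> //; exact: orb_compVr.
- move=> a h; apply/val_inj/sc_eq => C /mP[A [B [aA aB ABC]]].
  have {}aA : \val a (orb_swap act @^-1` A) := aA.
  apply: (@sc_filterS _ (\val a) _ _ _ (sc_filterI aA aB)) => x [Ax Bx].
  by apply: ABC; exists (orb_swap act x), x; split=> //; exact: orb_compVl.
Qed.

End CoarseGroupoid.

Theorem theorem3p4 (R : realType) (X : metricType R) (Gamma : groupType)
    (act : right_action Gamma X) :
  uniformly_discrete X -> bounded_geometry X ->
  countable [set: Gamma] ->
  proper_action act -> free_action act -> isometric_action act ->
  (exists! m, is_composition act m) /\
  (forall m, is_composition act m ->
     is_etale_groupoid (cg_range act) (cg_source act)
       (cg_unit act) (cg_inv act) m).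
Proof.
move=> _ bg _ _ free iso.
have [m0 m0P] := filter_comp_ex bg free iso.
have [cm0 m0c] := filter_comp_is_composition free m0P.
split=> [|m mc].
  by exists m0; split=> // m; exact: is_composition_unique.
(* Uniqueness identifies any composition with the one built from filters. *)
rewrite (is_composition_unique mc m0c); split; first split.
- exact: filter_comp_groupoid.
- exact: cg_map_continuous.
- exact: cg_map_continuous.
- by apply: cg_continuousP; exact: sc_map_continuous.
- by apply: cg_continuousP; exact: cg_map_continuous.
- exact: cm0.
- by apply: sc_map_local_homeomorphism => t p; exact: Delta_mod_fst_inj.
- by apply: sc_map_local_homeomorphism => t p; exact: Delta_mod_snd_inj.
Qed.
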